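(* Let $\lambda,y\in\mathbb C$ with $\lambda>0$, and let $C\neq 0$. Define polynomials $\{P_n^{\lambda,C,y}(x)\}_{n\ge 0}$ by $$\sum_{n\ge 0}P_n^{\lambda,C,y}(x)\,t^n=(C-2xt+yt^2)^{-\lambda}.$$ The coefficient matrix $A=(a_{n,k})_{n,k\ge 0}$ defined by $P_n^{\lambda,C,y}(x)=\sum_{k=0}^n a_{n,k}x^k$ has entries $$a_{n,k}=\begin{cases}\dfrac{(\lambda)_{\frac{n+k}{2}}\,2^k\,(-y)^{\frac{n-k}{2}}}{k!\,\bigl(\frac{n-k}{2}\bigr)!\,C^{\lambda+\frac{n+k}{2}}}&\text{if }n-k\ge 0\text{ and even},\\[2mm] 0&\text{otherwise}.\end{cases}$$ The inverse matrix $A^{-1}=(b_{n,k})_{n,k\ge 0}$ exists, such that $x^n=\sum_{k=0}^n b_{n,k}P_k^{\lambda,C,y}(x)$, with entries $$b_{n,k}=\begin{cases}\dfrac{n!\,(\lambda+k)\,y^{\frac{n-k}{2}}\,C^{\lambda+\frac{n+k}{2}}}{2^n\,\bigl(\frac{n-k}{2}\bigr)!\,(\lambda)_{\frac{n+k}{2}+1}}&\text{if }n-k\ge 0\text{ and even},\\[2mm] 0&\text{otherwise}.\end{cases}$$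
   Context: $(\lambda)_r=\lambda(\lambda+1)\cdots(\lambda+r-1)$, $(\lambda)_0=1$, is the rising factorial. The condition $\lambda>0$ means that $\lambda$ is a positive real number. The power $(C-2xt+yt^2)^{-\lambda}$ is the formal power series in $t$ given by $C^{-\lambda}\bigl(1-\frac{2x}{C}t+\frac{y}{C}t^2\bigr)^{-\lambda}$ expanded by the binomial series, with a fixed choice of the value $C^{\lambda}$ and $C^{\lambda+m}=C^\lambda C^m$ for integers $m$, $C^{-\lambda}=1/C^\lambda$. *)

(* Defs.v *)
From mathcomp Require Import all_boot all_order all_algebra.
From mathcomp Require Import complex.
From mathcomp Require Import all_classical all_reals all_analysis.

Set Implicit Arguments.
Unset Strict Implicit.
Unset Printing Implicit Defensive.
Import Order.TTheory GRing.Theory Num.Theory.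
Local Open Scope ring_scope.

Definition cexp (R : realType) (z : R[i]) : R[i] :=
  ((expR (complex.Re z) * cos (complex.Im z))
     +i* (expR (complex.Re z) * sin (complex.Im z)))%C.

(* [w] is one of the values of the multivalued power [c ^ a]: [L] ranges over
   all the logarithms of [c]. *)
Definition is_cpow (R : realType) (c a w : R[i]) : Prop :=
  exists L : R[i], cexp L = c /\ w = cexp (a * L).

Definition rising (K : fieldType) (a : K) (r : nat) : K :=
  \prod_(i < r) (a + i%:R).

Definition gbinom (K : fieldType) (a : K) (j : nat) : K :=
  (\prod_(i < j) (a - i%:R)) / j`!%:R.

(* A formal power series in t over {poly K} is given by its sequence of
   coefficients. For u with zero constant term in t, this is
   (1 + u) ^ a = \sum_j gbinom a j * u ^ j; only the indices j <= n contribute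
   to the coefficient of t^n, by [coef_expr_small]. *)
Definition binomial_series (K : fieldType) (a : K) (u : {poly {poly K}})
    : nat -> {poly K} :=
  fun n => \sum_(j < n.+1) gbinom a j *: (u ^+ j)`_n.

Lemma coef_expr_small (K : fieldType) (u : {poly {poly K}}) (j n : nat) :
  u`_0 = 0 -> (n < j)%N -> (u ^+ j)`_n = 0.
Proof.
move=> u0 nj; have /factor_theorem[v ->] : root u 0 by rewrite /root horner_coef0 u0.
by rewrite subr0 exprMn_comm; [rewrite coefMXn nj | exact: commr_polyX].
Qed.

(* (C - 2xt + yt^2) ^ (-l) = C^(-l) (1 - (2x/C) t + (y/C) t^2) ^ (-l), where
   the inner indeterminate of {poly {poly K}} is x, the outer one is t, and
   [Cl] is the chosen value of C^l. *)
Definition quad_power (K : fieldType) (l y C Cl : K) : nat -> {poly K} :=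
  fun n => Cl^-1 *:
    binomial_series (- l)
      (- ((2 / C) *: 'X)%:P * 'X + ((y / C)%:P)%:P * 'X^2) n.

Definition coefmx (K : fieldType) (P : nat -> {poly K}) : nat -> nat -> K :=
  fun n k => (P n)`_k.

Definition lower_triangular (K : fieldType) (A : nat -> nat -> K) : Prop :=
  forall n k, (n < k)%N -> A n k = 0.

(* The product of infinite matrices, when [A] is lower triangular. *)
Definition mulltmx (K : fieldType) (A B : nat -> nat -> K) : nat -> nat -> K :=
  fun n k => \sum_(j < n.+1) A n j * B j k.

Definition is_inverse_ltmx (K : fieldType) (A B : nat -> nat -> K) : Prop :=
  [/\ lower_triangular A,
      lower_triangular B,
      forall n k, mulltmx A B n k = (n == k)%:R
    & forall n k, mulltmx B A n k = (n == k)%:R].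

(* Main.v *)
Require Import Defs.
From mathcomp Require Import all_boot all_order all_algebra.
From mathcomp Require Import complex.
From mathcomp Require Import all_classical all_reals all_analysis.
From mathcomp Require Import ring zify.

Set Implicit Arguments.
Unset Strict Implicit.
Unset Printing Implicit Defensive.
Import Order.TTheory GRing.Theory Num.Theory.
Local Open Scope ring_scope.

(** The coefficient formula comes from expanding [(1 + u) ^ (- l)] for
    [u = - (2x/C) t + (y/C) t^2]: the monomial [x^k t^n] occurs only in [u ^ j]
    with [n + k = 2 j], where it arises from the single term of index [k] of the
    binomial theorem.  For the inverse, the entry [(n, k)] of [B A] with
    [n = k + 2 m], [m > 0], is up to a factor the alternating sum
    [\sum_i (-1)^i 'C(m, i) (l + k + 2 i) (l)_(k + i) / (l)_(k + m + i + 1)],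
    whose partial sums have a closed form containing ['C(m - 1, r)], which
    vanishes at [r = m]. *)

Lemma coef_quad_expr (K : fieldType) (a b : K) (j n k : nat) :
  ((- (a *: 'X)%:P * 'X + (b%:P)%:P * 'X^2 : {poly {poly K}}) ^+ j)`_n`_k =
  if (k <= j)%N && (n + k == j.*2)%N
  then 'C(j, k)%:R * (- a) ^+ k * b ^+ (j - k) else 0.
Proof.
rewrite addrC exprDn.
under eq_bigr => i _.
  (* Each binomial term is a single monomial, of degree i in x and 2j - i in t, so x^k t^n can only
     come from i = k. *)
  have -> : (b%:P%:P * 'X^2) ^+ (j - i) * (- (a *: 'X)%:P * 'X) ^+ i *+ 'C(j, i)
    = (('C(j, i)%:R * (- a) ^+ i * b ^+ (j - i)) *: 'X^i)%:P * 'X^(j.*2 - i)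
      :> {poly {poly K}}.
    have -> : (j.*2 - i = 2 * (j - i) + i)%N by have := ltn_ord i; lia.
    rewrite exprD exprM -mulr_natl -!mul_polyC !polyCM !polyC_exp !polyCN.
    rewrite !polyC_natr mulNr (exprNn (_ * 'X)) (exprNn a%:P%:P) !exprMn.
    ring.
  over.
rewrite !coef_sum.
under eq_bigr => i _ do rewrite coefCM coefXn mulr_natr coefMn coefZ coefXn.
case: ifPn => [/andP[kj /eqP nk]|cond].
  rewrite (bigD1 (Ordinal (kj : (k < j.+1)%N))) //= big1 ?addr0 => [|i].
    have -> : (n == j.*2 - k)%N by lia.
    by rewrite eqxx mulr1.
  rewrite -val_eqE /= => /negPf ik.
  by rewrite eq_sym ik mulr0 mul0rn.
rewrite big1 // => i _.
case: (eqVneq k i) => [ki|_]; last by rewrite mulr0 mul0rn.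
case: eqP => // ni; case/negP: cond.
by have := ltn_ord i; lia.
Qed.

Lemma risingS (K : fieldType) (a : K) r :
  rising a r.+1 = rising a r * (a + r%:R).
Proof. by rewrite /rising big_ord_recr. Qed.

Lemma rising_neq0 (K : numFieldType) (a : K) r : 0 < a -> rising a r != 0.
Proof.
move=> a0; apply/prodf_neq0 => i _.
by rewrite gt_eqF // ltr_wpDr // ler0n.
Qed.

Lemma gbinomN (K : fieldType) (a : K) j :
  gbinom (- a) j = (- 1) ^+ j * rising a j / j`!%:R.
Proof.
rewrite /gbinom /rising; congr (_ / _).
under eq_bigr => i _ do rewrite -opprD.
by rewrite prodrN card_ord.
Qed.

Definition gegen_coef (K : fieldType) (l y C Cl : K) (n k : nat) : K :=
  if (k <= n)%N && ~~ odd (n - k) then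
    rising l ((n + k)./2) * 2 ^+ k * (- y) ^+ ((n - k)./2)
    / (k`!%:R * ((n - k)./2)`!%:R * (Cl * C ^+ ((n + k)./2)))
  else 0.

Definition gegen_inv_coef (K : fieldType) (l y C Cl : K) (n k : nat) : K :=
  if (k <= n)%N && ~~ odd (n - k) then
    n`!%:R * (l + k%:R) * y ^+ ((n - k)./2) * (Cl * C ^+ ((n + k)./2))
    / (2 ^+ n * ((n - k)./2)`!%:R * rising l ((n + k)./2).+1)
  else 0.

Lemma fact_natr_neq0 (K : numFieldType) n : n`!%:R != 0 :> K.
Proof. by rewrite pnatr_eq0 -lt0n fact_gt0. Qed.

Lemma coefmx_quad_power (K : numFieldType) (l y C Cl : K) n k :
  C != 0 -> Cl != 0 ->
  coefmx (quad_power l y C Cl) n k = gegen_coef l y C Cl n k.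
Proof.
move=> C0 Cl0; rewrite /coefmx /quad_power /binomial_series /gegen_coef.
rewrite coefZ coef_sum.
under eq_bigr => j _ do rewrite coefZ coef_quad_expr.
case: ifPn => [/andP[kn e]|cond]; last first.
  rewrite big1 ?mulr0 // => j _.
  case: ifPn => [/andP[kj /eqP nk]|_]; last by rewrite mulr0.
  by case/negP: cond; have := ltn_ord j; lia.
have jP : ((n + k)./2 < n.+1)%N by lia.
rewrite (bigD1 (Ordinal jP)) //= big1 ?addr0 => [|j]; last first.
  rewrite -val_eqE /= => jn; case: ifPn; last by rewrite mulr0.
  by move=> H; case/negP: jn; lia.
have [m nE] : exists m, n = (k + m.*2)%N by exists (n - k)./2; lia.
have -> : ((n + k)./2 = k + m)%N by lia.
have -> : ((n - k)./2 = m)%N by lia.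
have -> : (k <= k + m)%N && (n + k == (k + m).*2)%N by lia.
rewrite gbinomN addKn -(bin_fact (leq_addr m k)) addKn !natrM.
rewrite (exprNn y m) (exprNn (2 / C) k) !exprMn !exprVn !exprD.
have b0 : 'C(k + m, k)%:R != 0 :> K by rewrite pnatr_eq0 -lt0n bin_gt0 leq_addr.
have s2 : (-1) ^+ k * (-1) ^+ k = 1 :> K by rewrite -expr2 sqrr_sign.
(* One sign (-1)^k comes from [gbinomN], the other from (-2/C)^k; they are kept apart as a factor
   equal to 1 by [s2]. *)
transitivity ((-1) ^+ k * (-1) ^+ k *
  (rising l (k + m) * 2 ^+ k * ((-1) ^+ m * y ^+ m) /
   (k`!%:R * m`!%:R * (Cl * (C ^+ k * C ^+ m))))); last by rewrite s2 mul1r.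
by field; rewrite ?fact_natr_neq0 ?expf_neq0 ?b0 ?Cl0.
Qed.

(** Induction on r: a closed form at every r makes the sum telescope, whereas the case used later, r
    = m.+1, only has the value 0 and gives nothing to induct on. *)
Lemma rising_alternating_sum (K : numFieldType) (l : K) k m r : 0 < l ->
  \sum_(i < r.+1) (-1) ^+ i * 'C(m.+1, i)%:R * (l + k%:R + 2 * i%:R)
     * rising l (k + i) / rising l (k + m.+1 + i).+1 =
  (-1) ^+ r * 'C(m, r)%:R * rising l (k + r).+1 / rising l (k + m.+1 + r).+1.
Proof.
move=> l0; elim: r => [|r IH].
  by rewrite big_ord1 !bin0 !addn0 mulr0 addr0 (risingS l k); ring.
rewrite big_ord_recr /= IH binS natrD.
(* The subtraction is taken in K, so the identity also covers r > m, where both binomials vanish. *)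
have E : r.+1%:R * 'C(m, r.+1)%:R = (m%:R - r%:R) * 'C(m, r)%:R :> K.
  have [rm|mr] := leqP r m; first by rewrite -natrB // -!natrM mul_bin_left.
  by rewrite !bin_small ?mulr0 //; lia.
rewrite (addnS k r) (addnS (k + m.+1) r).
rewrite (risingS l (k + m.+1 + r).+1) (risingS l (k + r).+1).
have := rising_neq0 (k + m.+1 + r).+1 l0.
have : l + (k + m.+1 + r).+1%:R != 0.
  by rewrite gt_eqF // ltr_wpDr // ler0n.
move: (rising l (k + m.+1 + r).+1) (rising l (k + r).+1) => U V.
move: E; move: ('C(m, r.+1)%:R : K) ('C(m, r)%:R : K) => p q E n0 U0.
apply/eqP; rewrite -subr_eq0; apply/eqP.
(* The difference of the two sides of the goal is a multiple of the difference of the two sides of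
   [E]. *)
transitivity ((-1) ^+ r * V / (U * (l + (k + m.+1 + r).+1%:R)) *
   ((m%:R - r%:R) * q - r.+1%:R * p)); last by rewrite E subrr mulr0.
move: n0; rewrite !exprS -!natr1 !natrD -!natr1 => n0.
by field; rewrite U0 n0.
Qed.

Lemma sum_parity (K : nmodType) (f : nat -> K) k m :
  (forall j, ~~ ((k <= j)%N && ~~ odd (j - k)) -> f j = 0) ->
  \sum_(j < (k + m.*2).+1) f j = \sum_(i < m.+1) f (k + i.*2)%N.
Proof.
move=> f0; elim: m => [|m IH].
  rewrite addn0 big_ord_recr big_ord1 addn0 /= big1 ?add0r // => j _.
  by apply: f0; have := ltn_ord j; lia.
(* Passing from m to m.+1 adds two indices, the first of which has the wrong parity. *)
rewrite doubleS !addnS 2!big_ord_recr IH /= [RHS]big_ord_recr /= doubleS !addnS.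
by rewrite f0 ?addr0 //; lia.
Qed.

Lemma gegen_inv_coefK (K : numFieldType) (l y C Cl : K) n k :
  0 < l -> C != 0 -> Cl != 0 ->
  mulltmx (gegen_inv_coef l y C Cl) (gegen_coef l y C Cl) n k = (n == k)%:R.
Proof.
move=> l0 C0 Cl0; rewrite /mulltmx.
have [/andP[kn e]|cond] := boolP ((k <= n)%N && ~~ odd (n - k)); last first.
  have -> : (n == k) = false by apply/eqP => nk; case/negP: cond; lia.
  (* A nonzero term would need k <= j <= n with n - j and j - k both even, which forces n - k to be
     even. *)
  rewrite big1 // => j _; rewrite /gegen_inv_coef /gegen_coef.
  case: ifPn => [H1|_]; last by rewrite mul0r.
  case: ifPn => [H2|_]; last by rewrite mulr0.
  by case/negP: cond; lia.
have [m ->] : exists m, n = (k + m.*2)%N by exists (n - k)./2; lia.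
rewrite (@sum_parity _ (fun j => gegen_inv_coef l y C Cl (k + m.*2) j *
  gegen_coef l y C Cl j k)) => [|j /negPf cj]; last first.
  by rewrite /gegen_coef cj mulr0.
(* With j = k + 2i, the powers of y and C combine to y^m and C^m up to the sign (-1)^i, [Cl]
   cancels, and 1 / (i! (m - i)!) is a binomial over m!; the remaining constant does not depend on
   i. *)
rewrite (eq_bigr (fun i : 'I__ => (k + m.*2)`!%:R * y ^+ m * C ^+ m * 2 ^+ k /
  (2 ^+ (k + m.*2) * k`!%:R * m`!%:R) *
  ((-1) ^+ i * 'C(m, i)%:R * (l + k%:R + 2 * i%:R)
     * rising l (k + i) / rising l (k + m + i).+1))); last first.
  move=> [i /=]; rewrite ltnS => im _.
  rewrite /gegen_inv_coef /gegen_coef.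
  have {im} [d ->] : exists d, m = (i + d)%N by exists (m - i)%N; lia.
  have -> : (k + i.*2 <= k + (i + d).*2)%N && ~~ odd (k + (i + d).*2 - (k + i.*2)).
    by lia.
  have -> : (k <= k + i.*2)%N && ~~ odd (k + i.*2 - k) by lia.
  have -> : ((k + (i + d).*2 - (k + i.*2))./2 = d)%N by lia.
  have -> : ((k + (i + d).*2 + (k + i.*2))./2 = k + (i + d) + i)%N by lia.
  have -> : ((k + i.*2 - k)./2 = i)%N by lia.
  have -> : ((k + i.*2 + k)./2 = k + i)%N by lia.
  rewrite -(bin_fact (leq_addr d i)) addKn !natrM.
  have b0 : 'C(i + d, i)%:R != 0 :> K by rewrite pnatr_eq0 -lt0n bin_gt0 leq_addr.
  rewrite (risingS l (k + (i + d) + i)).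
  have ln0 : l + (k + (i + d) + i)%:R != 0 by rewrite gt_eqF // ltr_wpDr // ler0n.
  rewrite (exprNn y) -!mul2n !exprD !(natrD, natrM) in ln0 *.
  by field; rewrite ?fact_natr_neq0 ?expf_neq0 ?b0 ?Cl0 ?rising_neq0 ?ln0.
(* The diagonal case m = 0 is computed directly; otherwise the closed form is taken at its last
   index, where its binomial is zero. *)
rewrite -mulr_sumr; case: m {kn e} => [|m].
  rewrite big_ord1 double0 !addn0 eqxx bin0 (risingS l k) mulr0 addr0.
  have := rising_neq0 k l0.
  have : l + k%:R != 0 by rewrite gt_eqF // ltr_wpDr // ler0n.
  move=> lk r0; rewrite !expr0 fact0 mulr1n.
  by field; rewrite ?fact_natr_neq0 ?expf_neq0 ?lk ?r0.
have -> : (k + m.+1.*2 == k)%N = false by lia.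
by rewrite rising_alternating_sum // bin_small // mulr0 !mul0r mulr0.
Qed.

(** Leading blocks transfer facts about finite square matrices to infinite triangular ones. *)
Definition truncmx (K : fieldType) (A : nat -> nat -> K) (N : nat) : 'M[K]_N :=
  \matrix_(i, j) A i j.

(** In row i the infinite product only sums over j <= i; the further terms i < j < N of the block
    product vanish by triangularity of A. *)
Lemma truncmx_mul (K : fieldType) (A B : nat -> nat -> K) N :
  lower_triangular A -> truncmx (mulltmx A B) N = truncmx A N *m truncmx B N.
Proof.
move=> ltA; apply/matrixP => i k; rewrite !mxE /mulltmx.
under [RHS]eq_bigr => j _ do rewrite !mxE.
rewrite (big_ord_widen N (fun j => A i j * B j k)) // big_mkcond /=.
by apply: eq_bigr => j _; rewrite ltnS; case: leqP => // /ltA ->; rewrite mul0r.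
Qed.

Lemma truncmx_eq1P (K : fieldType) (A : nat -> nat -> K) :
  (forall n k, A n k = (n == k)%:R) <-> (forall N, truncmx A N = 1%:M).
Proof.
split=> [A1 N|A1 n k]; first by apply/matrixP => i j; rewrite !mxE A1.
have nP : (n < (n + k).+1)%N by lia.
have kP : (k < (n + k).+1)%N by lia.
by have /matrixP/(_ (Ordinal nP) (Ordinal kP)) := A1 (n + k).+1; rewrite !mxE.
Qed.

(** A one-sided inverse of a finite square matrix is two-sided; this applies to every leading
    block. *)
Lemma mulltmx1C (K : fieldType) (A B : nat -> nat -> K) :
  lower_triangular A -> lower_triangular B ->
  (forall n k, mulltmx A B n k = (n == k)%:R) ->
  forall n k, mulltmx B A n k = (n == k)%:R.
Proof.
move=> ltA ltB /truncmx_eq1P AB; apply/truncmx_eq1P => N.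
by rewrite truncmx_mul // mulmx1C // -truncmx_mul.
Qed.

(** The usual B = B (A B') = (B A) B' = B', on a leading block large enough to contain the entry (n,
    k). *)
Lemma inverse_ltmx_uniq (K : fieldType) (A B B' : nat -> nat -> K) :
  is_inverse_ltmx A B -> is_inverse_ltmx A B' -> forall n k, B n k = B' n k.
Proof.
move=> [ltA ltB _ /truncmx_eq1P BA] [_ _ /truncmx_eq1P AB' _] n k.
have nP : (n < (n + k).+1)%N by lia.
have kP : (k < (n + k).+1)%N by lia.
have E : truncmx B (n + k).+1 = truncmx B' (n + k).+1.
  rewrite -[LHS]mulmx1 -AB' truncmx_mul // mulmxA -truncmx_mul //.
  by rewrite BA mul1mx.
by have /matrixP/(_ (Ordinal nP) (Ordinal kP)) := E; rewrite !mxE.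
Qed.

(** A zero would force the cosine and sine of the imaginary part to vanish together. This makes
    every value of C^lambda invertible. *)
Lemma cexp_neq0 (R : realType) (z : R[i]) : cexp z != 0.
Proof.
apply/eqP => -[/eqP + /eqP].
rewrite !mulf_eq0 (gt_eqF (expR_gt0 _)) /= => /eqP c0 /eqP s0.
by have /eqP := cos2Dsin2 (complex.Im z); rewrite c0 s0 expr0n addr0 eq_sym oner_eq0.
Qed.

Theorem corollary4p5 (R : realType) (lambda y C Clambda : R[i])
    (lambda_gt0 : 0 < lambda) (C_neq0 : C != 0)
    (ClambdaE : is_cpow C lambda Clambda)
    (P : nat -> {poly R[i]})
    (PE : forall n : nat, P n = quad_power lambda y C Clambda n) :
  [/\ forall n : nat, P n = \sum_(k < n.+1) coefmx P n k *: 'X^k,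
      forall n k : nat,
        coefmx P n k =
          if (k <= n)%N && ~~ odd (n - k) then
            rising lambda ((n + k)./2) * 2 ^+ k * (- y) ^+ ((n - k)./2)
            / (k`!%:R * ((n - k)./2)`!%:R * (Clambda * C ^+ ((n + k)./2)))
          else 0,
      exists B : nat -> nat -> R[i], is_inverse_ltmx (coefmx P) B
    & forall B : nat -> nat -> R[i], is_inverse_ltmx (coefmx P) B ->
        (forall n : nat, 'X^n = \sum_(k < n.+1) B n k *: P k) /\
        (forall n k : nat,
          B n k =
            if (k <= n)%N && ~~ odd (n - k) then
              n`!%:R * (lambda + k%:R) * y ^+ ((n - k)./2)
                * (Clambda * C ^+ ((n + k)./2))
              / (2 ^+ n * ((n - k)./2)`!%:R * rising lambda ((n + k)./2).+1)
            else 0)].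
Proof.
have Cl0 : Clambda != 0 by case: ClambdaE => L [_ ->]; exact: cexp_neq0.
have PcoefE n k : coefmx P n k = gegen_coef lambda y C Clambda n k.
  by rewrite /coefmx PE -coefmx_quad_power.
have ltP : lower_triangular (coefmx P).
  by move=> n k nk; rewrite PcoefE /gegen_coef leqNgt nk.
have ltB : lower_triangular (gegen_inv_coef lambda y C Clambda).
  by move=> n k nk; rewrite /gegen_inv_coef leqNgt nk.
have BP n k :
    mulltmx (gegen_inv_coef lambda y C Clambda) (coefmx P) n k = (n == k)%:R.
  rewrite -(gegen_inv_coefK y n k lambda_gt0 C_neq0 Cl0).
  by apply: eq_bigr => j _; rewrite PcoefE.
have invP : is_inverse_ltmx (coefmx P) (gegen_inv_coef lambda y C Clambda).
  by split=> //; exact: mulltmx1C.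
split=> //.
- move=> n; apply/polyP => k; rewrite -poly_def coef_poly ltnS.
  by case: leqP => // nk; exact: ltP.
- by exists (gegen_inv_coef lambda y C Clambda).
move=> B invB; split=> [n|n k]; last exact: inverse_ltmx_uniq invB invP n k.
(* The coefficient of x^k in the expansion is the entry (n, k) of the product of B with the
   coefficient matrix. *)
apply/polyP => k; rewrite coefXn coef_sum.
have [_ _ _ /(_ n k)] := invB; rewrite eq_sym => <-.
by apply: eq_bigr => j _; rewrite coefZ.
Qed.
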